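(* If $P$ is a nonempty pattern, then there are integers $n_1,\ldots,n_r\ge1$, $k_1,\ldots,k_r\ge0$ and vectors $v_1,\ldots,v_r\in\mathbb{Z}^2$ such that $P\in\gamma\left(\bigcup_{i=1}^r (v_i+P_{n_i,k_i})\right)$, the patterns $v_i+P_{n_i,k_i}$ pairwise do not touch, $\sum_{i=1}^r n_i=|P|-e(P)$ and $\sum_{i=1}^r k_i=e(P)$.
   Context: A pattern is a finite subset $P\subset\mathbb{Z}^2$. Let $T=\{(0,1),(1,1),(1,0)\}$ and $T_n=\{(a,b)\in\{0,\ldots,n-1\}^2 : a+b\geq n-1\}$. A solitaire move applies to $P$ at $v$ when $|P\cap(v+T)|=2$ and replaces $P$ by $(P\setminus(v+T))\cup S$ for an arbitrary two-element $S\subset v+T$; $\gamma(P)$ is the set of patterns reachable by finitely many moves. The filling $\varphi(P)$ is obtained by repeatedly adding a point $w$ whenever there is $v$ with $|P\cap(v+T)|=2$ (current set) and $w\in v+T$, until stable. Let $N(x)=\{x\pm(1,0),x\pm(0,1),x\pm(1,-1)\}$ and $N(A)=\bigcup_{x\in A}N(x)$. The filling decomposes uniquely (up to order) as $\varphi(P)=\bigcup_{i=1}^r(v_i+T_{k_i})$ with $N(v_i+T_{k_i})\cap(v_j+T_{k_j})=\varnothing$ for $i\ne j$; the excess is $e(P)=|P|-\sum_i k_i$. Two patterns $A,B$ touch if $\varphi(A)\cap N(\varphi(B))\ne\varnothing$ or $\varphi(B)\cap N(\varphi(A))\neq\varnothing$. For $0\le k\le n(n-1)/2$, the pattern $P_{n,k}$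 consists of the top row $\{(a,n-1):0\le a\le n-1\}$ of $T_n$ together with the first $k$ points of $T_n\setminus\{(a,n-1)\}$ in the order listing rows from top to bottom (decreasing second coordinate) and, within each row, from right to left (decreasing first coordinate). *)

(* Defs.v *)
From mathcomp Require Import all_boot all_order all_algebra finmap zify boolp.
From Stdlib Require Export Relation_Operators.

Set Implicit Arguments.
Unset Strict Implicit.
Unset Printing Implicit Defensive.

Import Order.TTheory GRing.Theory Num.Theory.
Local Open Scope fset_scope.
Local Open Scope ring_scope.

Notation point := (int * int)%type.
Definition pattern : Type := {fset point}.

Definition translate (v : point) (A : pattern) : pattern :=
  [fset v + x | x in A].

Definition cellT : pattern := [fset (0, 1); (1, 1); (1, 0)].

Definition triangle (n : nat) : pattern :=
  [fset x in [seq (a%:Z, b%:Z) | a <- iota 0 n, b <- iota 0 n]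
     | n%:Z - 1 <= x.1 + x.2].

Definition solitaire_move (P Q : pattern) : Prop :=
  exists (v : point) (S : pattern),
    [/\ #|` P `&` translate v cellT| = 2%N,
        S `<=` translate v cellT,
        #|` S| = 2%N
      & Q = (P `\` translate v cellT) `|` S].

(* gamma P Q means that Q belongs to the orbit of P. *)
Definition gamma (P Q : pattern) : Prop :=
  clos_refl_trans pattern solitaire_move P Q.

Definition fill_step (P Q : pattern) : Prop :=
  exists (v w : point),
    [/\ #|` P `&` translate v cellT| = 2%N,
        w \in translate v cellT
      & Q = w |` P].

Definition fill_stable (P : pattern) : Prop :=
  forall Q, fill_step P Q -> Q = P.

Definition is_filling (P F : pattern) : Prop :=
  clos_refl_trans pattern fill_step P F /\ fill_stable F.

Definition neighbours (x : point) : pattern :=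
  [fset x + (1, 0); x - (1, 0); x + (0, 1); x - (0, 1);
        x + (1, -1); x - (1, -1)].

Definition neighbourhood (A : pattern) : pattern :=
  \bigcup_(x <- A) neighbours x.

(* An element (v, k) of D stands for the triangle v + T_k.  Using a set of   *)
(* such pairs, all with k >= 1, makes the decomposition a genuine one: since *)
(* x is not in N(x), a one-point triangle repeated twice would satisfy the   *)
(* separation condition, and empty triangles could be added freely.          *)
Definition is_triangle_decomposition
    (F : pattern) (D : {fset point * nat}) : Prop :=
  [/\ forall t, t \in D -> (0 < t.2)%N,
      F = \bigcup_(t <- D) translate t.1 (triangle t.2)
    & forall t u, t \in D -> u \in D -> t != u ->
        neighbourhood (translate t.1 (triangle t.2))
          `&` translate u.1 (triangle u.2) = fset0].

Lemma in_translate v A x : (x \in translate v A) = (x - v \in A).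
Proof.
apply/imfsetP/idP => [[y /= yA ->]|xA]; first by rewrite addrC addKr.
by exists (x - v) => //=; rewrite addrC subrK.
Qed.

Lemma in_cell v x : (x \in translate v cellT) =
  [|| x == (v.1, v.2 + 1), x == (v.1 + 1, v.2 + 1) | x == (v.1 + 1, v.2)].
Proof.
by rewrite in_translate /cellT !inE; case: x v => a b [c d] /=;
   rewrite !xpair_eqE /= /GRing.add /=; lia.
Qed.

Lemma in_triangle v n x : (x \in translate v (triangle n)) =
  [&& x.1 - v.1 < n%:Z, x.2 - v.2 < n%:Z
    & n%:Z - 1 <= (x.1 - v.1) + (x.2 - v.2)].
Proof.
rewrite in_translate /triangle !inE; case: x v => a b [c d] /=.
apply/andP/and3P => [[/allpairsP[[i j]]] /=|[h1 h2 h3]].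
  rewrite !mem_iota => -[hi hj [-> ->]] h; split; lia.
split; last lia.
apply/allpairsP; exists (`|a - c|%N, `|b - d|%N); rewrite !mem_iota /=.
by split; [lia|lia|congr pair => /=; lia].
Qed.

Lemma in_neighbours x y : (y \in neighbours x) =
  ((y.1 - x.1, y.2 - x.2) \in
    [:: (1, 0); (-1, 0); (0, 1); (0, -1); (1, -1); (-1, 1)]).
Proof.
rewrite /neighbours !inE; case: x y => a b [c d] /=.
rewrite !xpair_eqE /=.
lia.
Qed.

Lemma neighbourhoodP A y :
  reflect (exists2 x, x \in A & y \in neighbours x) (y \in neighbourhood A).
Proof.
apply: (iffP (bigfcupP _ _ _ _)) => [[x /andP[xA _] yx]|[x xA yx]].
  by exists x.
by exists x => //; rewrite xA.
Qed.

Lemma card_cell v : #|` translate v cellT| = 3%N.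
Proof.
rewrite card_in_imfset //=; first by rewrite /cellT fsetUC cardfsU1 cardfs2 !inE.
by move=> x y _ _ /addrI.
Qed.

Lemma stable_cell F v x y z : fill_stable F ->
  x \in translate v cellT -> y \in translate v cellT ->
  z \in translate v cellT -> x != y -> x \in F -> y \in F -> z \in F.
Proof.
move=> sF xv yv zv xy xF yF.
have h2 : (1 < #|` F `&` translate v cellT|)%N.
  have -> : 2%N = #|` [fset x; y]| by rewrite cardfs2 xy.
  apply: fsubset_leq_card; apply/fsubsetP => w; rewrite !inE.
  by case/orP => /eqP->; rewrite ?xF ?yF ?xv ?yv.
case: (eqVneq #|` F `&` translate v cellT| 2%N) => [e|ne].
  by rewrite -(sF (z |` F)) ?fset1U1 //; exists v, z.
have : F `&` translate v cellT = translate v cellT.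
  apply/eqP; rewrite eqEfcard fsubsetIr /= card_cell.
  by rewrite ltn_neqAle eq_sym ne.
by move/fsetP/(_ z); rewrite in_fsetI zv andbT.
Qed.

Lemma card2_elems (A : pattern) : #|` A| = 2%N ->
  exists x y, [/\ x != y, x \in A & y \in A].
Proof.
move=> c2; have /fset0Pn[x xA] : A != fset0 by rewrite -cardfs_gt0 c2.
have /fset0Pn[y] : A `\ x != fset0.
  by move: c2; rewrite (cardfsD1 x) xA -cardfs_gt0; lia.
by rewrite !inE => /andP[yx yA]; exists x, y; rewrite eq_sym.
Qed.

Lemma fill_sub_stable P Q F : fill_stable F -> P `<=` F ->
  clos_refl_trans pattern fill_step P Q -> Q `<=` F.
Proof.
move=> sF PF PQ; elim: PQ PF => {P Q} [P Q [v [w [c2 wv ->]]] PF||] //; last first.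
  by move=> P Q R _ h1 _ h2 /h1/h2.
rewrite fsubUset PF andbT fsub1set.
have [x [y [xy xP yP]]] := card2_elems c2.
move: xP yP; rewrite !(in_fsetI P) => /andP[xP xv] /andP[yP yv].
by apply: (stable_cell sF xv yv wv xy); apply: (fsubsetP PF).
Qed.

Lemma fill_sub P Q : clos_refl_trans pattern fill_step P Q -> P `<=` Q.
Proof.
elim=> {P Q} [P Q [v [w [_ _ ->]]]|P|P Q R _ h1 _ h2].
- exact: fsubsetU1.
- exact: fsubset_refl.
- exact: fsubset_trans h1 h2.
Qed.

Lemma is_filling_uniq P F G : is_filling P F -> is_filling P G -> F = G.
Proof.
move=> [PF sF] [PG sG]; apply/eqP; rewrite eqEfsubset.
by rewrite (fill_sub_stable sG (fill_sub PG) PF)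
           (fill_sub_stable sF (fill_sub PF) PG).
Qed.

Lemma triangle_stable v n : fill_stable (translate v (triangle n)).
Proof.
move=> Q [u [w [c2 wu ->]]]; apply/fsetUidPr; rewrite fsub1set.
set A := translate v _ in c2 *.
have [x [y [xy xP yP]]] := card2_elems c2.
move: xP yP wu xy; rewrite /A !in_fsetI !in_triangle !in_cell.
case: x y w u v {c2 A Q} => [x1 x2] [y1 y2] [w1 w2] [u1 u2] [v1 v2] /=.
rewrite !xpair_eqE; lia.
Qed.

Lemma in_some_triangle (P : pattern) :
  exists v n, P `<=` translate v (triangle n).
Proof.
suff [v [n h]] : exists v n, {subset (P : seq _) <= translate v (triangle n)}.
  by exists v, n; apply/fsubsetP => x; apply: h.
elim: (P : seq point) => [|[a b] s [[c d] [n IH]]]; first by exists 0, 0%N.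
have [m hm] : exists m : nat, `|a| + `|b| + `|c| + `|d| + n%:Z < m%:Z.
  by exists (`|a| + `|b| + `|c| + `|d| + n).+1%N; lia.
exists (c - 2 * m%:Z, d - 2 * m%:Z), (n + 3 * m)%N => -[y z].
by rewrite inE => /orP[/eqP[-> ->]|/IH]; rewrite !in_triangle /=; lia.
Qed.

Lemma filling_exists P : exists F, is_filling P F.
Proof.
have [v [n]] := in_some_triangle P; set A := translate _ _ => PA.
have [m] := ubnP (#|` A| - #|` P|)%N; elim: m => // m IH in P PA *.
rewrite ltnS => le_m.
have [sP|/existsNP[Q /not_implyP[PQ QP]]] := pselect (fill_stable P).
  by exists P; split=> //; apply: rt_refl.
have PQ' : P `<=` Q by apply/fill_sub/rt_step.
have QA : Q `<=` A by apply: fill_sub_stable PA (rt_step _ _ _ _ PQ);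
  apply: triangle_stable.
have ltPQ : (#|` P| < #|` Q|)%N.
  apply: fproper_ltn_card; rewrite fproperEneq PQ' andbT.
  by apply/eqP => e; apply: QP.
have leQA := fsubset_leq_card QA.
have [|F [QF sF]] := IH Q QA; first lia.
by exists F; split=> //; apply: rt_trans QF; apply: rt_step.
Qed.

Definition filling (P : pattern) : pattern := sval (cid (filling_exists P)).

Lemma fillingP P : is_filling P (filling P).
Proof. exact: svalP (cid (filling_exists P)). Qed.

Section Triangles.

Let tri (t : point * nat) : pattern := translate t.1 (triangle t.2).

Let in_tri v n (a b : int) : ((a, b) \in tri (v, n)) =
  [&& a - v.1 < n%:Z, b - v.2 < n%:Z & n%:Z - 1 <= (a - v.1) + (b - v.2)].
Proof. exact: in_triangle. Qed.

Let tri_inj t u : (0 < t.2)%N -> (0 < u.2)%N -> tri t = tri u -> t = u.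
Proof.
case: t u => [[a b] n] [[c d] m] /= n0 m0 /fsetP e.
have := e (a + n%:Z - 1, b + n%:Z - 1).
have := e (c + m%:Z - 1, d + m%:Z - 1).
have := e (a, b + n%:Z - 1).
have := e (c, d + m%:Z - 1).
have := e (a + n%:Z - 1, b).
have := e (c + m%:Z - 1, d).
rewrite !in_tri /= => h1 h2 h3 h4 h5 h6.
have [ea eb en] : [/\ a = c, b = d & n = m] by split; lia.
by rewrite ea eb en.
Qed.

Let tri_connected t (X : pattern) x0 : x0 \in tri t -> x0 \in X ->
  (forall x y, x \in X -> x \in tri t -> y \in neighbours x -> y \in tri t ->
    y \in X) -> tri t `<=` X.
Proof.
case: t => [[c d] n] x0t x0X step.
have n0 : (0 < n)%N by move: x0t; case: x0 {x0X} => a b; rewrite in_tri /=; lia.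
have hstep (a b a' b' : int) : (a, b) \in X -> (a, b) \in tri ((c, d), n) ->
    (a', b') \in tri ((c, d), n) ->
    (a' - a, b' - b) \in [:: (1, 0); (-1, 0); (0, 1); (0, -1) : point] ->
    (a', b') \in X.
  move=> h1 h2 h3 h4; apply: (step (a, b)) => //.
  by rewrite in_neighbours /=; move: h4; rewrite !inE !xpair_eqE; lia.
have ax : (c + n%:Z - 1, d + n%:Z - 1) \in X.
  have right i (a b : int) : (a, b) \in X -> (a, b) \in tri ((c, d), n) ->
      (a + i%:Z, b) \in tri ((c, d), n) -> (a + i%:Z, b) \in X.
    elim: i a => [|i IH] a abX abt; first by rewrite addr0.
    move=> h; have -> : a + i.+1%:Z = (a + 1) + i%:Z by lia.
    have t1 : (a + 1, b) \in tri ((c, d), n) by move: abt h; rewrite !in_tri /=; lia.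
    apply: IH => //.
    - by apply: (hstep a b) => //; rewrite !inE !xpair_eqE; lia.
    - by move: h; rewrite !in_tri /=; lia.
  have up i (a b : int) : (a, b) \in X -> (a, b) \in tri ((c, d), n) ->
      (a, b + i%:Z) \in tri ((c, d), n) -> (a, b + i%:Z) \in X.
    elim: i b => [|i IH] b abX abt; first by rewrite addr0.
    move=> h; have -> : b + i.+1%:Z = (b + 1) + i%:Z by lia.
    have t1 : (a, b + 1) \in tri ((c, d), n) by move: abt h; rewrite !in_tri /=; lia.
    apply: IH => //.
    - by apply: (hstep a b) => //; rewrite !inE !xpair_eqE; lia.
    - by move: h; rewrite !in_tri /=; lia.
  case: x0 x0t x0X => a b x0t x0X.
  have h1 : (c + n%:Z - 1, b) \in X.
    have -> : c + n%:Z - 1 = a + (absz (c + n%:Z - 1 - a)%R)%:Z.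
      by move: x0t; rewrite in_tri /=; lia.
    by apply: right => //; move: x0t; rewrite !in_tri /=; lia.
  have -> : d + n%:Z - 1 = b + (absz (d + n%:Z - 1 - b)%R)%:Z.
    by move: x0t; rewrite in_tri /=; lia.
  by apply: up => //; move: x0t; rewrite !in_tri /=; lia.
have left i : (i < n)%N -> (c + n%:Z - 1 - i%:Z, d + n%:Z - 1) \in X.
  elim: i => [|i IH] lti; first by rewrite subr0.
  apply: (hstep _ _ _ _ (IH (ltnW lti))).
  - by rewrite in_tri /=; lia.
  - by rewrite in_tri /=; lia.
  - by rewrite !inE !xpair_eqE; lia.
have down i j : (i + j < n)%N ->
    (c + n%:Z - 1 - i%:Z, d + n%:Z - 1 - j%:Z) \in X.
  elim: j => [|j IH] lti; first by rewrite subr0 left //; lia.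
  have lti' : (i + j < n)%N by lia.
  apply: (hstep _ _ _ _ (IH lti')).
  - by rewrite in_tri /=; lia.
  - by rewrite in_tri /=; lia.
  - by rewrite !inE !xpair_eqE; lia.
apply/fsubsetP => -[a b]; rewrite in_tri /= => h.
have := down (absz (c + n%:Z - 1 - a)%R) (absz (d + n%:Z - 1 - b)%R).
have -> : c + n%:Z - 1 - (absz (c + n%:Z - 1 - a)%R)%:Z = a by lia.
have -> : d + n%:Z - 1 - (absz (d + n%:Z - 1 - b)%R)%:Z = b by lia.
by apply; lia.
Qed.

Let decomposition_sub F D D' t u x :
  is_triangle_decomposition F D -> is_triangle_decomposition F D' ->
  t \in D -> u \in D' -> x \in tri t -> x \in tri u -> tri t `<=` tri u.
Proof.
move=> [_ eF _] [_ eF' sep] tD uD xt xu.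
apply: (tri_connected xt xu) => y z yu yt zy zt.
have : z \in F by rewrite eF; apply/bigfcupP; exists t; rewrite ?tD.
rewrite eF' => /bigfcupP[u' /andP[u'D _] zu'].
have [<-//|ne] := eqVneq u' u.
have : z \in neighbourhood (tri u) `&` tri u'.
  by rewrite in_fsetI zu' andbT; apply/neighbourhoodP; exists y.
by rewrite sep // eq_sym.
Qed.

Let apex_in (t : point * nat) : (0 < t.2)%N ->
  (t.1.1 + t.2%:Z - 1, t.1.2 + t.2%:Z - 1) \in tri t.
Proof. by case: t => [[a b] n] /=; rewrite in_tri /=; lia. Qed.

Lemma triangle_decomposition_uniq F D D' :
  is_triangle_decomposition F D -> is_triangle_decomposition F D' -> D = D'.
Proof.
suff sub E E' : is_triangle_decomposition F E ->
    is_triangle_decomposition F E' -> E `<=` E'.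
  by move=> h h'; apply/eqP; rewrite eqEfsubset !sub.
move=> dE dE'; apply/fsubsetP => t tE.
have [posE eF _] := dE; have [posE' eF' _] := dE'.
have xt := apex_in (posE _ tE); set x := (_, _) in xt.
have : x \in F by rewrite eF; apply/bigfcupP; exists t; rewrite ?tE.
rewrite eF' => /bigfcupP[u /andP[uE' _] xu].
suff -> : t = u by [].
apply: (tri_inj (posE _ tE) (posE' _ uE')); apply/eqP; rewrite eqEfsubset.
by rewrite (decomposition_sub dE dE' tE uE' xt xu)
           (decomposition_sub dE' dE uE' tE xu xt).
Qed.

Let tri_grow F t x : fill_stable F -> (0 < t.2)%N -> tri t `<=` F ->
  x \in neighbourhood (tri t) -> x \in F -> x \notin tri t ->
  exists u, [/\ u.2 = t.2.+1, tri t `<=` tri u & tri u `<=` F].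
Proof.
move=> sF; case: t => [[c d] n] /= n0 tF /neighbourhoodP[[a b] abt].
have inF (a' b' : int) : (a', b') \in tri ((c, d), n) -> (a', b') \in F.
  exact: (fsubsetP tF).
have cell v p q r : p \in F -> q \in F -> p != q ->
    p \in translate v cellT -> q \in translate v cellT ->
    r \in translate v cellT -> r \in F.
  by move=> pF qF pq pv qv rv; apply: (stable_cell sF pv qv rv pq).
case: x => x y; rewrite in_neighbours /= => nb xyF xyt.
move: abt xyt nb; rewrite !in_tri /= !inE !xpair_eqE => abt xyt nb.
have [hA|[hB|hC]] : x - c = n%:Z \/ y - d = n%:Z \/
    (x - c) + (y - d) = n%:Z - 2 by lia.
-
  exists ((c, d - 1), n.+1); split=> //.
    by apply/fsubsetP => -[p q]; rewrite !in_tri /=; lia.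
  have up i : y + i%:Z - d < n%:Z -> (x, y + i%:Z) \in F.
    elim: i => [|i IH] hi; first by rewrite addr0.
    apply: (cell (x - 1, y + i%:Z) (x, y + i%:Z) (x - 1, y + i%:Z + 1)).
    + by apply: IH; lia.
    + by apply: inF; rewrite in_tri /=; lia.
    + by rewrite xpair_eqE; lia.
    + by rewrite in_cell /= !xpair_eqE; lia.
    + by rewrite in_cell /= !xpair_eqE; lia.
    + by rewrite in_cell /= !xpair_eqE; lia.
  have down i : - 1 <= y - i%:Z - d -> (x, y - i%:Z) \in F.
    elim: i => [|i IH] hi; first by rewrite subr0.
    apply: (cell (x - 1, y - i%:Z - 1) (x, y - i%:Z) (x - 1, y - i%:Z)).
    + by apply: IH; lia.
    + by apply: inF; rewrite in_tri /=; lia.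
    + by rewrite xpair_eqE; lia.
    + by rewrite in_cell /= !xpair_eqE; lia.
    + by rewrite in_cell /= !xpair_eqE; lia.
    + by rewrite in_cell /= !xpair_eqE; lia.
  apply/fsubsetP => -[p q]; rewrite in_tri /= => h.
  have [pq|npq] := boolP ((p, q) \in tri ((c, d), n)); first exact: inF.
  have -> : p = x by move: npq; rewrite in_tri /=; lia.
  have [le|lt] := lerP y q.
    have -> : q = y + (absz (q - y)%R)%:Z by lia.
    by apply: up; lia.
  have -> : q = y - (absz (y - q)%R)%:Z by lia.
  by apply: down; lia.
-
  exists ((c - 1, d), n.+1); split=> //.
    by apply/fsubsetP => -[p q]; rewrite !in_tri /=; lia.
  have up i : x + i%:Z - c < n%:Z -> (x + i%:Z, y) \in F.
    elim: i => [|i IH] hi; first by rewrite addr0.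
    apply: (cell (x + i%:Z, y - 1) (x + i%:Z, y) (x + i%:Z + 1, y - 1)).
    + by apply: IH; lia.
    + by apply: inF; rewrite in_tri /=; lia.
    + by rewrite xpair_eqE; lia.
    + by rewrite in_cell /= !xpair_eqE; lia.
    + by rewrite in_cell /= !xpair_eqE; lia.
    + by rewrite in_cell /= !xpair_eqE; lia.
  have down i : - 1 <= x - i%:Z - c -> (x - i%:Z, y) \in F.
    elim: i => [|i IH] hi; first by rewrite subr0.
    apply: (cell (x - i%:Z - 1, y - 1) (x - i%:Z, y) (x - i%:Z, y - 1)).
    + by apply: IH; lia.
    + by apply: inF; rewrite in_tri /=; lia.
    + by rewrite xpair_eqE; lia.
    + by rewrite in_cell /= !xpair_eqE; lia.
    + by rewrite in_cell /= !xpair_eqE; lia.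
    + by rewrite in_cell /= !xpair_eqE; lia.
  apply/fsubsetP => -[p q]; rewrite in_tri /= => h.
  have [pq|npq] := boolP ((p, q) \in tri ((c, d), n)); first exact: inF.
  have -> : q = y by move: npq; rewrite in_tri /=; lia.
  have [le|lt] := lerP x p.
    have -> : p = x + (absz (p - x)%R)%:Z by lia.
    by apply: up; lia.
  have -> : p = x - (absz (x - p)%R)%:Z by lia.
  by apply: down; lia.
-
  exists ((c - 1, d - 1), n.+1); split=> //.
    by apply/fsubsetP => -[p q]; rewrite !in_tri /=; lia.
  have up i : x + i%:Z - c < n%:Z -> (x + i%:Z, y - i%:Z) \in F.
    elim: i => [|i IH] hi; first by rewrite addr0 subr0.
    apply: (cell (x + i%:Z, y - i%:Z - 1) (x + i%:Z, y - i%:Z)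
                 (x + i%:Z + 1, y - i%:Z)).
    + by apply: IH; lia.
    + by apply: inF; rewrite in_tri /=; lia.
    + by rewrite xpair_eqE; lia.
    + by rewrite in_cell /= !xpair_eqE; lia.
    + by rewrite in_cell /= !xpair_eqE; lia.
    + by rewrite in_cell /= !xpair_eqE; lia.
  have down i : y + i%:Z - d < n%:Z -> (x - i%:Z, y + i%:Z) \in F.
    elim: i => [|i IH] hi; first by rewrite subr0 addr0.
    apply: (cell (x - i%:Z - 1, y + i%:Z) (x - i%:Z, y + i%:Z)
                 (x - i%:Z, y + i%:Z + 1)).
    + by apply: IH; lia.
    + by apply: inF; rewrite in_tri /=; lia.
    + by rewrite xpair_eqE; lia.
    + by rewrite in_cell /= !xpair_eqE; lia.
    + by rewrite in_cell /= !xpair_eqE; lia.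
    + by rewrite in_cell /= !xpair_eqE; lia.
  apply/fsubsetP => -[p q]; rewrite in_tri /= => h.
  have [pq|npq] := boolP ((p, q) \in tri ((c, d), n)); first exact: inF.
  have epq : p + q = x + y by move: npq; rewrite in_tri /=; lia.
  have [le|lt] := lerP x p.
    have -> : p = x + (absz (p - x)%R)%:Z by lia.
    have -> : q = y - (absz (p - x)%R)%:Z by lia.
    by apply: up; lia.
  have -> : p = x - (absz (x - p)%R)%:Z by lia.
  have -> : q = y + (absz (x - p)%R)%:Z by lia.
  by apply: down; lia.
Qed.

Let size_tri t : (t.2 <= #|` tri t|)%N.
Proof.
case: t => [[c d] n] /=.
pose f (i : 'I_n) : point := (c + i%:Z, d + n%:Z - 1).
have f_inj : injective f by move=> i j [h]; apply: val_inj => /=; lia.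
have {1}<- : size [seq f i | i <- enum 'I_n] = n by rewrite size_map size_enum_ord.
apply: uniq_leq_size => [|y /mapP[i _ ->]]; first by rewrite map_inj_uniq ?enum_uniq.
by rewrite /f in_tri /=; have := ltn_ord i; lia.
Qed.

Lemma triangle_decomposition_exists F :
  fill_stable F -> exists D, is_triangle_decomposition F D.
Proof.
move=> sF.
pose C : {fset point * nat} := [fset t in
  [seq ((x.1 - n%:Z + 1, x.2 - n%:Z + 1), n) | x <- F, n <- iota 1 #|` F|]
  | tri t `<=` F].
have inC t : (t \in C) = (0 < t.2)%N && (tri t `<=` F).
  rewrite /C !inE /=; have [tF|] := boolP (tri t `<=` F); last by rewrite !andbF.
  rewrite !andbT; apply/allpairsP/idP => [[[x n] /= [_]]|t0].
    by rewrite mem_iota => /andP[n0 _] ->.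
  exists ((t.1.1 + t.2%:Z - 1, t.1.2 + t.2%:Z - 1), t.2) => /=; split.
  - exact: (fsubsetP tF _ (apex_in t0)).
  - by rewrite mem_iota add1n ltnS t0 (leq_trans (size_tri t)) ?fsubset_leq_card.
  - by case: t {tF t0} => [[a b] n] /=; congr ((_, _), _); lia.
clearbody C.
pose D := [fset t in C | all (fun u => (tri t `<=` tri u) ==> (u == t)) C].
have inD t : t \in D -> [/\ (0 < t.2)%N, tri t `<=` F &
    forall u, (0 < u.2)%N -> tri u `<=` F -> tri t `<=` tri u -> u = t].
  rewrite /D !inE inC => /andP[/andP[t0 tF] /allP h]; split=> // u u0 uF tu.
  by apply/eqP; move: (h u); rewrite inC u0 uF tu; apply.
have maxD t : t \in C -> exists2 u, u \in D & tri t `<=` tri u.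
  have [m] := ubnP (#|` F| - #|` tri t|)%N; elim: m => // m IH in t *.
  rewrite ltnS => le_m tC.
  have [tD|] := boolP (t \in D); first by exists t.
  rewrite !inE tC /= => /allPn[u uC]; rewrite negb_imply => /andP[tu ut].
  have [|//|w wD uw] := IH u; last by exists w => //; apply: fsubset_trans uw.
  move: tC uC; rewrite !inC => /andP[t0 tF] /andP[u0 uF].
  have : (#|` tri t| < #|` tri u|)%N.
    apply: fproper_ltn_card; rewrite fproperEneq tu andbT.
    by apply: contra ut => /eqP/(tri_inj t0 u0) ->.
  by have := fsubset_leq_card uF; lia.
have closedD t x : t \in D -> x \in neighbourhood (tri t) -> x \in F ->
    x \in tri t.
  move=> /inD[t0 tF tmax] xt xF; apply/negPn/negP => nxt.
  have [u [u2 tu uF]] := tri_grow sF t0 tF xt xF nxt.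
  by have := tmax u; rewrite u2 => /(_ isT uF tu) e; move: u2; rewrite e; lia.
exists D; split=> [t /inD[]//||t u tD uD ne].
  apply/fsetP => x; apply/idP/bigfcupP => [xF|[t /andP[/inD[_ tF _] _]]]; last first.
    exact: (fsubsetP tF).
  have xx y : (y \in tri (x, 1%N)) = (y == x).
    by case: x y {xF} => a b [a' b']; rewrite in_tri xpair_eqE /=; lia.
  have [|t tD xt] := maxD (x, 1%N).
    by rewrite inC /=; apply/fsubsetP => y; rewrite xx => /eqP->.
  by exists t; rewrite ?tD //; apply: (fsubsetP xt); rewrite xx.
apply/fsetP => x; rewrite in_fsetI [RHS]in_fset0; apply/negP => /andP[xt xu].
have [t0 tF tmax] := inD _ tD; have [u0 uF umax] := inD _ uD.
have xt' := closedD _ _ tD xt (fsubsetP uF _ xu).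
have ut : tri u `<=` tri t.
  apply: (tri_connected xu xt') => y z yt yu zy zu.
  apply: (closedD t) => //; last exact: (fsubsetP uF).
  by apply/neighbourhoodP; exists y.
by case/eqP: ne; apply: umax.
Qed.

End Triangles.

Lemma filling_triangles_exist P :
  exists D, is_triangle_decomposition (filling P) D.
Proof. exact: triangle_decomposition_exists (fillingP P).2. Qed.

Definition filling_triangles (P : pattern) : {fset point * nat} :=
  sval (cid (filling_triangles_exist P)).

Lemma filling_trianglesP P :
  is_triangle_decomposition (filling P) (filling_triangles P).
Proof. exact: svalP (cid (filling_triangles_exist P)). Qed.

Definition excess (P : pattern) : int :=
  #|` P|%:Z - \sum_(t <- filling_triangles P) t.2%:Z.

Definition touch (A B : pattern) : Prop :=
  filling A `&` neighbourhood (filling B) <> fset0 \/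
  filling B `&` neighbourhood (filling A) <> fset0.

(* T_n without its top row: rows from top to bottom, each from right to left. *)
Definition lower_rows (n : nat) : seq point :=
  [seq x <- [seq (a%:Z, b%:Z) | b <- rev (iota 0 n.-1), a <- rev (iota 0 n)]
     | x \in triangle n].

(* Meaningful for k <= n (n - 1) / 2; larger values of k are truncated.       *)
Definition Ppattern (n k : nat) : pattern :=
  [fset (a%:Z, n%:Z - 1) | a in iota 0 n] `|` [fset x in take k (lower_rows n)].

(* Main.v *)
(* If C can be moved to D, then every pattern containing C can be moved to    *)
(* one containing D.  The top row of T_n can be moved to each of the three    *)
(* sides, where it absorbs an adjacent point into the top row of some         *)
(* T_{n+1}, and all patterns of a given size between the top row and T_n lie  *)
(* in one orbit.                                                              *)
(*   Given P, move it to a disjoint union of C and R, with C between a top    *)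
(* row and its triangle and |C| maximal.  By absorption no pattern in the     *)
(* orbit of R meets the triangle or its neighbourhood.  By induction R lies   *)
(* in the orbit of a non-touching union of translates of the P_{n,k}; every   *)
(* point of its filling is occupied by some pattern of the orbit, so the      *)
(* filling of R is far from the triangle and the excesses of C and R add up.  *)

Require Import Defs.
From mathcomp Require Import all_boot all_algebra finmap zify boolp.

Set Implicit Arguments.
Unset Strict Implicit.
Unset Printing Implicit Defensive.

Import GRing.Theory.
Local Open Scope fset_scope.
Local Open Scope ring_scope.

Notation tri v n := (translate v%R (triangle n%N)).

Lemma cardfsU_disjoint (K : choiceType) (A B : {fset K}) :
  [disjoint A & B]%fset -> #|` A `|` B| = (#|` A| + #|` B|)%N.
Proof. by move=> dAB; apply/eqP; rewrite (leq_card_fsetU A B). Qed.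

Lemma big_fsetU_disjoint (R : Type) (idx : R) (op : Monoid.com_law idx)
    (I : choiceType) (A B : {fset I}) (F : I -> R) : [disjoint A & B]%fset ->
  \big[op/idx]_(i <- A `|` B) F i =
    op (\big[op/idx]_(i <- A) F i) (\big[op/idx]_(i <- B) F i).
Proof.
move=> /fdisjointP_sym dAB; rewrite -big_cat; apply/perm_big/uniq_perm.
- exact: fset_uniq.
- rewrite cat_uniq !fset_uniq andbT; apply/hasPn => i /dAB //.
- by move=> i; rewrite mem_cat in_fsetU.
Qed.

Lemma cardfs3_uniq (K : choiceType) (x y z : K) :
  (#|` [fset x; y; z]| == 3%N) = uniq [:: x; y; z].
Proof.
rewrite fsetUC cardfsU1 cardfs2 /= !inE !(eq_sym z).
by case: (x == y) (x == z) (y == z) => [] [] [].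
Qed.

(** * Moves and fillings *)

Lemma gamma_refl P : gamma P P.
Proof. exact: rt_refl. Qed.

Lemma gamma_trans Q P R : gamma P Q -> gamma Q R -> gamma P R.
Proof. exact: rt_trans. Qed.

Lemma solitaire_move_sym P Q : solitaire_move P Q -> solitaire_move Q P.
Proof.
move=> [v [S [c2 Sv S2 ->]]]; exists v, (P `&` translate v cellT).
have -> : (P `\` translate v cellT `|` S) `&` translate v cellT = S.
  by apply/fsetP => x; rewrite !inE; have := fsubsetP Sv x; lia.
split=> //; first exact: fsubsetIr.
by apply/fsetP => x; rewrite !inE; have := fsubsetP Sv x; lia.
Qed.

Lemma gamma_sym P Q : gamma P Q -> gamma Q P.
Proof.
elim=> [A B /solitaire_move_sym|A|A B C _ BA _ CB]; first exact: rt_step.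
  exact: gamma_refl.
exact: gamma_trans CB BA.
Qed.

Lemma card_solitaire_move P Q : solitaire_move P Q -> #|` Q| = #|` P|.
Proof.
move=> [v [S [c2 Sv S2 ->]]]; rewrite cardfsU_disjoint ?S2.
  by rewrite -c2 addnC cardfsID.
by apply/fdisjointP => x; rewrite !inE; have := fsubsetP Sv x; lia.
Qed.

Lemma gamma_card P Q : gamma P Q -> #|` Q| = #|` P|.
Proof.
by elim=> [A B /card_solitaire_move|A|A B C _ eAB _ eBC] //; rewrite eBC.
Qed.

Definition is_cell (x y z : point) : Prop :=
  exists v, translate v cellT = [fset x; y; z].

Lemma is_cellI v x y z : x \in translate v cellT -> y \in translate v cellT ->
  z \in translate v cellT -> uniq [:: x; y; z] -> is_cell x y z.
Proof.
move=> xv yv zv; rewrite -cardfs3_uniq => /eqP c3.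
exists v; apply/esym/eqP; rewrite eqEfcard card_cell c3 andbT.
by apply/fsubsetP => w; rewrite !inE -orbA => /or3P[]/eqP->.
Qed.

Lemma is_cell_swap x y z : is_cell x y z -> is_cell y x z.
Proof. by case=> v e; exists v; rewrite e [_ `|` [fset y]]fsetUC. Qed.

Lemma is_cell_rot x y z : is_cell x y z -> is_cell y z x.
Proof.
by case=> v e; exists v; rewrite e; apply/fsetP => w; rewrite !inE; lia.
Qed.

Lemma is_cell_uniq x y z : is_cell x y z -> uniq [:: x; y; z].
Proof. by case=> v e; rewrite -cardfs3_uniq -e card_cell. Qed.

Lemma gamma_move P x y z : is_cell x y z ->
  x \in P -> y \notin P -> z \notin P -> gamma (y |` P) (z |` P).
Proof.
move=> xyz; have := is_cell_uniq xyz; case: xyz => v e.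
rewrite /= !inE andbT negb_or => /andP[/andP[xy xz] yz] xP yP zP.
apply: rt_step; exists v, [fset x; z]; rewrite e !cardfs2 xz; split=> //.
- suff -> : (y |` P) `&` [fset x; y; z] = [fset x; y] by rewrite cardfs2 xy.
  apply/fsetP => w; rewrite !inE.
  have [->|_] := eqVneq w x; first by rewrite xP orbT.
  have [->|_] := eqVneq w y; first by [].
  by have [->|_] := eqVneq w z; rewrite ?andbF // (negbTE zP).
- by apply/fsubsetP => w; rewrite !inE; lia.
apply/fsetP => w; rewrite !inE.
have [->|_] := eqVneq w x; first by rewrite xP orbT.
by have [->|_] := eqVneq w y; rewrite ?(negbTE yz) ?(negbTE yP) //=; lia.
Qed.

(* Two cells meeting in q: q is spent to fill b, then recovered from y. *)
Lemma gamma_relay P b a q s y : is_cell b a q -> is_cell q s y ->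
  a \in P -> q \in P -> s \in P -> y \notin P -> b \notin P -> y != b ->
  gamma (y |` P) (b |` P).
Proof.
move=> /is_cell_rot aqb /is_cell_rot syq aP qP sP yP bP yb.
have /and3P[] := is_cell_uniq aqb; have /and3P[] := is_cell_uniq syq.
rewrite !inE !negb_or => /andP[_ sq] yq _ /andP[aq _] qb _.
rewrite -[P in y |` P](fsetD1K qP) fsetUCA.
apply: (@gamma_trans (b |` (y |` P `\ q))).
  apply: (gamma_move aqb); rewrite !inE ?eqxx.
  - by rewrite aq aP orbT.
  - by rewrite orbF eq_sym.
  - by rewrite (negbTE bP) andbF orbF eq_sym.
rewrite fsetUCA -[P in gamma _ (b |` P)](fsetD1K qP) [b |` (q |` _)]fsetUCA.
apply: (gamma_move syq); rewrite !inE ?eqxx.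
- by rewrite sq sP orbT.
- by rewrite (negbTE yP) andbF orbF.
- by rewrite orbF.
Qed.

Lemma fill_stableI F :
  (forall v x y z, x \in translate v cellT -> y \in translate v cellT ->
     z \in translate v cellT -> x != y -> x \in F -> y \in F -> z \in F) ->
  fill_stable F.
Proof.
move=> closed Q [v [w [c2 wv ->]]]; apply/fsetUidPr; rewrite fsub1set.
have [x [y [xy]]] := card2_elems c2; rewrite !(in_fsetI F).
by move=> /andP[xF xv] /andP[yF yv]; apply: (closed v x y).
Qed.

Lemma sub_filling P : P `<=` filling P.
Proof. exact: fill_sub (fillingP P).1. Qed.

Lemma filling_stable P : fill_stable (filling P).
Proof. exact: (fillingP P).2. Qed.

Lemma filling_min P F : fill_stable F -> P `<=` F -> filling P `<=` F.
Proof. by move=> sF PF; apply: (fill_sub_stable sF PF); case: (fillingP P). Qed.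

Lemma filling_mono P Q : P `<=` Q -> filling P `<=` filling Q.
Proof.
move=> PQ; apply: filling_min; first exact: filling_stable.
exact: fsubset_trans PQ (sub_filling Q).
Qed.

Lemma cell_sub_filling P v : #|` P `&` translate v cellT| = 2%N ->
  translate v cellT `<=` filling P.
Proof.
move=> c2; have [x [y [xy]]] := card2_elems c2; rewrite !(in_fsetI P).
move=> /andP[xP xv] /andP[yP yv]; apply/fsubsetP => z zv.
apply: (stable_cell (@filling_stable P) xv yv zv xy);
  exact: (fsubsetP (sub_filling P)).
Qed.

Lemma gamma_filling P Q : gamma P Q -> filling Q = filling P.
Proof.
have sub A B : solitaire_move A B -> filling B `<=` filling A.
  move=> [v [S [c2 Sv S2 ->]]]; apply: filling_min; first exact: filling_stable.
  rewrite fsubUset (fsubset_trans Sv (cell_sub_filling c2)) andbT.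
  exact: fsubset_trans (fsubsetDl _ _) (sub_filling A).
elim=> [A B m|A|A B C _ eAB _ eBC] //; last by rewrite eBC.
by apply/eqP; rewrite eqEfsubset (sub _ _ m) (sub _ _ (solitaire_move_sym m)).
Qed.

Lemma gamma_sub_filling P Q F : gamma P Q -> fill_stable F ->
  P `<=` F -> Q `<=` F.
Proof.
move=> PQ sF PF; apply: fsubset_trans (sub_filling Q) _.
by rewrite (gamma_filling PQ); apply: filling_min.
Qed.

Lemma solitaire_move_fsetU v (S P Z : pattern) :
  [disjoint Z & translate v cellT]%fset ->
  #|` P `&` translate v cellT| = 2%N -> S `<=` translate v cellT ->
  #|` S| = 2%N ->
  solitaire_move (P `|` Z) ((P `\` translate v cellT `|` S) `|` Z).
Proof.
move=> /fdisjointP dZ c2 Sv S2; exists v, S; split=> //.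
  rewrite -[RHS]c2; congr (#|` _|); apply/fsetP => x.
  by rewrite !inE; have := dZ x; lia.
by apply/fsetP => x; rewrite !inE; have := dZ x; lia.
Qed.

Lemma gamma_fsetU P Q Z : gamma P Q -> [disjoint Z & filling P]%fset ->
  gamma (P `|` Z) (Q `|` Z).
Proof.
elim=> {P Q} [P Q [v [S [c2 Sv S2 ->]]] dZ|P _|P Q R PQ IHPQ _ IHQR dZ].
- apply/rt_step/solitaire_move_fsetU => //.
  by apply: fdisjointWr dZ; apply: cell_sub_filling.
- exact: gamma_refl.
- by apply: gamma_trans (IHPQ dZ) _; apply: IHQR; rewrite (gamma_filling PQ).
Qed.

Definition reaches (P C : pattern) : Prop := exists2 Q, gamma P Q & C `<=` Q.

Lemma reaches_sub X C D : C `<=` X -> gamma C D -> reaches X D.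
Proof.
move=> + CD; elim: CD X => {C D}
  [C D [v [S [c2 Sv S2 ->]]]|C|C D E _ IHC _ IHD].
- (* Either the cell meets X in the same two points, and X can move too, or *)
  (* it lies inside X, which then already contains the result of the move.  *)
  move=> X CX; set c := translate v cellT in c2 Sv *.
  have sub : C `&` c `<=` X `&` c by apply: fsetSI.
  have [e2|ne2] := eqVneq #|` X `&` c| 2%N.
    exists (X `\` c `|` S); first by apply: rt_step; exists v, S.
    exact/fsetSU/fsetSD.
  have cX : X `&` c = c.
    apply/eqP; rewrite eqEfcard fsubsetIr card_cell /=.
    by rewrite ltn_neqAle eq_sym ne2 -c2 fsubset_leq_card.
  exists X; first exact: gamma_refl.
  rewrite fsubUset (fsubset_trans (fsubsetDl _ _) CX) /=.
  by apply: fsubset_trans Sv _; rewrite -cX fsubsetIl.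
- by move=> X CX; exists X => //; apply: gamma_refl.
- move=> X /IHC[Y XY /IHD[Z YZ EZ]]; exists Z => //.
  exact: gamma_trans YZ.
Qed.

Lemma reaches_mono P X C : P `<=` X -> reaches P C -> reaches X C.
Proof.
move=> PX [Q /(reaches_sub PX)[Y XY QY] CQ]; exists Y => //.
exact: fsubset_trans QY.
Qed.

Lemma reaches_gamma P C D : reaches P C -> gamma C D -> reaches P D.
Proof.
move=> [Q PQ CQ] /(reaches_sub CQ)[Y QY DY]; exists Y => //.
exact: gamma_trans QY.
Qed.

(** * Sliding along strips *)

Definition seg (p : nat -> point) (n : nat) : pattern :=
  [fset p i | i in iota 0 n].

Lemma segP p n x : reflect (exists2 i, (i < n)%N & x = p i) (x \in seg p n).
Proof.
apply: (iffP (imfsetP _ _ _ _)) => -[i /=]; rewrite ?mem_iota => i_lt ->;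
  by exists i; rewrite //= mem_iota.
Qed.

Lemma mem_seg p n i : (i < n)%N -> p i \in seg p n.
Proof. by move=> i_lt; apply/segP; exists i. Qed.

Lemma mem_seg_inj p n i : injective p -> (p i \in seg p n) = (i < n)%N.
Proof.
by move=> p_inj; apply/segP/idP => [[j j_lt /p_inj->]|i_lt] //; exists i.
Qed.

Lemma seg0 p : seg p 0 = fset0.
Proof. by apply/fsetP => x; rewrite in_fset0; apply/segP => -[]. Qed.

Lemma segS p n : seg p n.+1 = p n |` seg p n.
Proof.
apply/fsetP => x; rewrite in_fset1U.
apply/segP/predU1P => [[i]|[->|/segP[i i_lt ->]]].
- rewrite ltnS leq_eqVlt => /predU1P[->|i_lt] ->; first by left.
  by right; apply: mem_seg.
- by exists n.
- by exists i => //; apply: leqW.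
Qed.

Lemma seg_recl p n : seg p n.+1 = p 0%N |` seg (p \o succn) n.
Proof.
apply/fsetP => x; rewrite in_fset1U.
apply/segP/predU1P => [[[|i] i_lt ->]|[->|/segP[i i_lt ->]]].
- by left.
- by right; apply/segP; exists i.
- by exists 0%N.
- by exists i.+1.
Qed.

Lemma card_seg p n : injective p -> #|` seg p n| = n.
Proof.
by move=> p_inj; rewrite card_imfset //= undup_id ?iota_uniq // size_iota.
Qed.

Lemma subset_seg p m n : (m <= n)%N -> seg p m `<=` seg p n.
Proof.
move=> le_mn; apply/fsubsetP => x /segP[i i_lt ->].
exact/mem_seg/(leq_trans i_lt).
Qed.

Definition strip (p q : nat -> point) : Prop :=
  [/\ injective p, injective q, forall i j, p i != q j
    & forall i, is_cell (p i) (p i.+1) (q i)].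

Section Strip.

Variables p q : nat -> point.
Hypothesis pq_strip : strip p q.

Lemma strip_disjoint m n : [disjoint seg p m & seg q n]%fset.
Proof.
have [_ _ pq _] := pq_strip; apply/fdisjointP => x /segP[i _ ->].
by apply/segP => -[j _]; apply/eqP.
Qed.

Lemma gamma_step_down m n Z : (m <= n)%N -> q n \in Z ->
  p n \notin Z -> p n.+1 \notin Z ->
  gamma (p n.+1 |` (seg p m `|` Z)) (p n |` (seg p m `|` Z)).
Proof.
have [p_inj _ _ cell] := pq_strip => le_mn qZ pZ pZ'.
apply: (@gamma_move _ (q n)).
- exact/is_cell_rot/is_cell_rot/is_cell_swap/cell.
- by rewrite in_fsetU qZ orbT.
- by rewrite in_fsetU negb_or mem_seg_inj // -leqNgt leqW.
- by rewrite in_fsetU negb_or mem_seg_inj // -leqNgt le_mn.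
Qed.

Lemma gamma_slide_to_seg n A Z : A `<=` seg p n -> seg q n.-1 `<=` Z ->
  [disjoint seg p n & Z]%fset -> gamma (A `|` Z) (seg p #|` A| `|` Z).
Proof.
have [p_inj _ _ _] := pq_strip; elim: n A Z => [|n IHn] A Z Ap qZ dZ.
  move: Ap; rewrite seg0 fsubset0 => /eqP->.
  by rewrite cardfs0 seg0; apply: gamma_refl.
have IH B Z' : B `<=` seg p n -> Z `<=` Z' -> [disjoint seg p n & Z']%fset ->
    gamma (B `|` Z') (seg p #|` B| `|` Z').
  move=> Bp ZZ' dZ'; apply: IHn => //; apply: fsubset_trans ZZ'.
  by apply: fsubset_trans qZ; apply/subset_seg/leq_pred.
have dZn : [disjoint seg p n & Z]%fset.
  by apply: fdisjointWl dZ; apply: subset_seg.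
have pZ i : (i <= n)%N -> p i \notin Z.
  by move=> i_le; apply: (fdisjointP dZ); apply: mem_seg.
have [pA|pA] := boolP (p n \in A); last first.
  by apply: IH => //; move: Ap; rewrite segS -fsubDset mem_fsetD1.
have : A `\ p n `<=` seg p n by rewrite fsubDset -segS.
rewrite (cardfsD1 (p n)) pA add1n -[A in gamma (A `|` _)](fsetD1K pA).
move: (A `\ p n) => {Ap pA}A Ap; rewrite -fsetUA fsetUCA.
(* Once the other points are packed, the last one has a free place below. *)
apply: gamma_trans (IH A _ Ap (fsubsetU1 _ _) _) _.
  by rewrite fdisjoint_sym fdisjointU1X mem_seg_inj // ltnn fdisjoint_sym.
have := fsubset_leq_card Ap; rewrite card_seg // fsetUCA leq_eqVlt.
case/predU1P => [->|]; first by rewrite segS -fsetUA; apply: gamma_refl.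
move: #|` A| => m {A Ap} lt_mn; have n0 := leq_ltn_trans (leq0n m) lt_mn.
have := @gamma_step_down m n.-1 Z; rewrite -ltnS prednK // => down.
apply: gamma_trans (down lt_mn _ _ _) _; rewrite ?pZ ?leq_pred //.
  by rewrite (fsubsetP qZ) // mem_seg // prednK.
have -> : m.+1 = #|` p n.-1 |` seg p m|.
  by rewrite cardfsU1 card_seg // mem_seg_inj // -leqNgt -ltnS prednK ?lt_mn.
rewrite fsetUA; apply: IH => //.
by rewrite fsubUset fsub1set mem_seg ?prednK // subset_seg // ltnW.
Qed.

Lemma gamma_slide n A B Z : A `<=` seg p n -> B `<=` seg p n ->
  #|` A| = #|` B| -> seg q n.-1 `<=` Z -> [disjoint seg p n & Z]%fset ->
  gamma (A `|` Z) (B `|` Z).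
Proof.
move=> Ap Bp cAB qZ dZ; apply: gamma_trans (gamma_slide_to_seg Ap qZ dZ) _.
by rewrite cAB; apply/gamma_sym/(gamma_slide_to_seg Bp qZ dZ).
Qed.

Lemma gamma_zigzag n y Z : y \in seg p n.+1 ->
  [disjoint seg p n.+1 `|` seg q n & Z]%fset ->
  gamma (y |` seg q n `|` Z) (seg p n.+1 `|` Z).
Proof.
have [p_inj q_inj pq cell] := pq_strip.
elim: n y Z => [|n IHn] y Z.
  by move=> /segP[[|//] _ ->] _; rewrite segS !seg0; apply: gamma_refl.
move=> yp; rewrite fdisjointUX => /andP[dpZ dqZ].
have pZ i : (i <= n.+1)%N -> p i \notin Z.
  by move=> i_le; apply: (fdisjointP dpZ); apply: mem_seg.
have qZ : q n \notin Z by apply: (fdisjointP dqZ); apply: mem_seg.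
have dpq := strip_disjoint.
apply: (@gamma_trans (p n.+1 |` (seg q n.+1 `|` Z))).
  rewrite -fsetUA; apply: (@gamma_slide n.+2); rewrite ?fsub1set ?cardfs1 //.
  - exact: mem_seg.
  - exact: fsubsetUl.
  - by rewrite fdisjointXU dpq.
have -> : p n.+1 |` (seg q n.+1 `|` Z) = q n |` (p n.+1 |` (seg q n `|` Z)).
  by rewrite [seg q n.+1]segS -fsetUA fsetUCA.
apply: (@gamma_trans (p n |` (p n.+1 |` (seg q n `|` Z)))).
  apply: (@gamma_move _ (p n.+1)); first exact/is_cell_rot/cell.
  - exact: fset1U1.
  - rewrite !inE !negb_or eq_sym pq qZ andbT; apply/segP => -[i i_lt /q_inj ei].
    by rewrite ei ltnn in i_lt.
  - rewrite in_fset1U in_fsetU !negb_or (inj_eq p_inj) ltn_eqF // pZ // andbT.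
    by apply: (fdisjointP (dpq n.+1 n)); apply: mem_seg.
rewrite [seg p n.+2]segS -fsetUA ![p n.+1 |` (_ `|` Z)]fsetUCA fsetUA.
apply: IHn; first exact: mem_seg.
rewrite fdisjointXU fdisjointX1 in_fsetU negb_or mem_seg_inj // ltnn /=.
rewrite (fdisjointP (dpq n.+2 n)) ?mem_seg //= fdisjointUX.
by rewrite (fdisjointWl _ dpZ) ?(fdisjointWl _ dqZ) ?subset_seg.
Qed.

End Strip.

(** * The sides of a triangle *)

Inductive edge := Top | Right | Diagonal.

Definition side_point (e : edge) (v : point) (n i : nat) : point :=
  match e with
  | Top => (v.1 + i%:Z, v.2 + n%:Z - 1)
  | Right => (v.1 + n%:Z - 1, v.2 + i%:Z)
  | Diagonal => (v.1 + i%:Z, v.2 + n%:Z - 1 - i%:Z)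
  end.

Definition side (e : edge) (v : point) (n : nat) : pattern :=
  seg (side_point e v n) n.

Arguments side e v%_R n%_N.

Definition shrink (e : edge) (v : point) : point :=
  match e with
  | Top => (v.1 + 1, v.2)
  | Right => (v.1, v.2 + 1)
  | Diagonal => (v.1 + 1, v.2 + 1)
  end.

Lemma side_point_inj e v n : injective (side_point e v n).
Proof. by case: e => i j []; lia. Qed.

Lemma card_side e v n : #|` side e v n| = n.
Proof. exact/card_seg/side_point_inj. Qed.

Lemma in_side e v n x : (x \in side e v n) = (x \in tri v n) &&
  match e with
  | Top => x.2 - v.2 == n%:Z - 1
  | Right => x.1 - v.1 == n%:Z - 1
  | Diagonal => (x.1 - v.1) + (x.2 - v.2) == n%:Z - 1
  end.
Proof.
rewrite in_triangle; apply/segP/idP => [[i i_lt ->]|].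
  by case: e => /=; lia.
case: x => a b /= x_side.
exists (absz (if e is Right then b - v.2 else a - v.1)).
  by case: e x_side => /=; lia.
by case: e x_side => /= x_side; congr pair; lia.
Qed.

Lemma side_sub e v n : side e v n `<=` tri v n.
Proof. by apply/fsubsetP => x; rewrite in_side => /andP[]. Qed.

Lemma tri0 v : tri v 0 = fset0.
Proof. by apply/fsetP => -[a b]; rewrite in_triangle in_fset0 /=; lia. Qed.

Lemma triS e v n : tri v n.+1 = side e v n.+1 `|` tri (shrink e v) n.
Proof.
apply/fsetP => -[a b]; rewrite in_fsetU in_side !in_triangle /=.
by case: e => /=; lia.
Qed.

Lemma side_shrink_disjoint e v n A B : A `<=` side e v n.+1 ->
  B `<=` tri (shrink e v) n -> [disjoint A & B]%fset.
Proof.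
move=> As Bt; apply: fdisjointWl As (fdisjointWr Bt _).
apply/fdisjointP => -[a b]; rewrite in_side !in_triangle /=.
by case: (e) => /=; lia.
Qed.

Lemma card_tri v n : #|` tri v n| = 'C(n.+1, 2).
Proof.
elim: n v => [|n IHn] v; first by rewrite tri0 cardfs0.
rewrite (triS Top) cardfsU_disjoint; last first.
  exact: (@side_shrink_disjoint Top v n).
by rewrite card_side IHn [RHS]binS bin1 addnC.
Qed.

Lemma side_strip e v n :
  strip (side_point e v n.+1) (side_point e (shrink e v) n).
Proof.
split; try exact: side_point_inj.
  by move=> i j; case: e; rewrite xpair_eqE /=; lia.
move=> i; apply: (@is_cellI (side_point e v n i));
  by case: e; rewrite ?in_cell /= ?inE ?xpair_eqE /=; lia.
Qed.

Lemma gamma_side_shrink e v n y : y \in side e v n.+1 ->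
  gamma (side e v n.+1) (y |` side e (shrink e v) n).
Proof.
move=> yS; have := gamma_zigzag (side_strip e v n) yS (fdisjointX0 _).
by rewrite !fsetU0 => /gamma_sym.
Qed.

Lemma gamma_fsetU1 z P Q : z \notin filling P -> gamma P Q ->
  gamma (z |` P) (z |` Q).
Proof.
move=> zP PQ; rewrite ![z |` _]fsetUC; apply: gamma_fsetU PQ _.
by rewrite fdisjoint1X.
Qed.

Lemma filling_sub_tri P v n : P `<=` tri v n -> filling P `<=` tri v n.
Proof. exact/filling_min/triangle_stable. Qed.

Lemma gamma_side_fsetU1 e v n z Q : z \notin tri v n -> gamma (side e v n) Q ->
  gamma (z |` side e v n) (z |` Q).
Proof.
move=> zv; apply: gamma_fsetU1; apply: contra zv.
exact/fsubsetP/filling_sub_tri/side_sub.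
Qed.

Lemma side_notin_shrink e v n x : x \in side e v n.+1 ->
  x \notin tri (shrink e v) n.
Proof. exact/fdisjointP/side_shrink_disjoint. Qed.

Lemma side_peel_top e v n : e <> Top -> exists2 z, z \in side Top v n.+1 &
  side e v n.+1 = z |` side e (shrink Top v) n.
Proof.
exists (if e is Diagonal then v.1 else v.1 + n%:Z, v.2 + n%:Z).
  by rewrite in_side in_triangle /=; case: e H => //=; lia.
apply/fsetP => -[a b]; rewrite in_fset1U !in_side !in_triangle xpair_eqE /=.
by case: e H => //=; lia.
Qed.

Lemma gamma_top_side e v n : gamma (side Top v n) (side e v n).
Proof.
elim: n v => [|n IHn] v; first by rewrite /side !seg0; apply: gamma_refl.
have [eT|ne] : e = Top \/ e <> Top by case: (e); [left|right|right].
  by rewrite eT; apply: gamma_refl.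
have [z zT ->] := side_peel_top v n ne.
apply: gamma_trans (gamma_side_shrink zT) _.
exact/gamma_side_fsetU1/IHn/side_notin_shrink.
Qed.

Lemma top_reaches v n y : y \in tri v n -> reaches (side Top v n) [fset y].
Proof.
elim: n v => [|n IHn] v; first by rewrite tri0.
rewrite (triS Top) in_fsetU => /orP[yT|/IHn[Q TQ yQ]].
  by exists (side Top v n.+1); rewrite ?fsub1set //; apply: gamma_refl.
have zT : side_point Top v n.+1 0 \in side Top v n.+1 by apply: mem_seg.
exists (side_point Top v n.+1 0 |` Q); last first.
  exact: fsubset_trans yQ (fsubsetU1 _ _).
apply: gamma_trans (gamma_side_shrink zT) _.
exact/gamma_side_fsetU1/TQ/side_notin_shrink.
Qed.

(** * Patterns between the top row and the triangle *)

Definition framed (v : point) (n : nat) (P : pattern) : bool :=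
  (side Top v n `<=` P) && (P `<=` tri v n).

Lemma framed_top v n : framed v n (side Top v n).
Proof. by rewrite /framed fsubset_refl side_sub. Qed.

Lemma filling_framed v n P : framed v n P -> filling P = tri v n.
Proof.
move=> /andP[TP Pv]; apply/eqP; rewrite eqEfsubset filling_sub_tri //=.
apply/fsubsetP => y /top_reaches[Q TQ]; rewrite fsub1set => yQ.
apply: (fsubsetP (filling_mono TP)); rewrite -(gamma_filling TQ).
exact: (fsubsetP (sub_filling Q)).
Qed.

Lemma card_framed v n P : framed v n P -> (n <= #|` P|)%N.
Proof. by case/andP=> /fsubset_leq_card + _; rewrite card_side. Qed.

Lemma framed_fsetD1 v n P y : framed v n P -> y \notin side Top v n ->
  framed v n (P `\ y).
Proof.
move=> /andP[TP Pv] yT; rewrite /framed fsubsetD1 TP yT.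
exact: fsubset_trans (fsubD1set _ _) Pv.
Qed.

Lemma framed_exchange v n P y : framed v n P -> (n < #|` P|)%N ->
  y \in tri v n -> exists Q, [/\ framed v n Q, #|` Q| = #|` P| & y \in Q].
Proof.
move=> fP ltnP yv; have [yP|yP] := boolP (y \in P); first by exists P.
have /andP[TP Pv] := fP.
have /fset0Pn[z] : P `\` side Top v n != fset0.
  by rewrite -cardfs_gt0 cardfsDS // card_side subn_gt0.
rewrite in_fsetD => /andP[zT zP].
exists (y |` P `\ z); rewrite fset1U1; split=> //.
  have /andP[TPz Pzv] := framed_fsetD1 fP zT.
  by rewrite /framed fsubUset fsub1set yv Pzv (fsubset_trans TPz) ?fsubsetU1.
by rewrite cardfsU1 !inE (negbTE yP) andbF (cardfsD1 z P) zP.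
Qed.

Lemma gamma_raise_point v n a C (w := shrink Top v) (p := side_point Top v n.+1)
    (r := side_point Top (shrink Top w) n.-1 0) :
  (1 < n)%N -> (0 < a <= n)%N -> framed w n C -> r \in C ->
  gamma (seg (p \o succn) a `|` C) (seg p a.+1 `|` C `\ r).
Proof.
move=> n1 /andP[a0 lea] /andP[TC Cw] rC; pose q := side_point Top w n.
have [p_inj _ _ pq_cell] : strip p q := side_strip Top v n.
have := side_strip Top w n.-1.
rewrite prednK ?(ltnW n1) // => -[_ _ qr qr_cell].
have qC i : (i < n)%N -> q i \in C `\ r.
  by move=> i_lt; rewrite in_fsetD1 qr (fsubsetP TC) ?mem_seg.
have pC i : (i < n.+1)%N -> p i \notin C.
  by move=> i_lt; apply/(contra (fsubsetP Cw _))/side_notin_shrink/mem_seg.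
rewrite seg_recl -fsetUA -{1}(fsetD1K rC) fsetUCA.
apply: (gamma_relay (pq_cell 0%N) (qr_cell 0%N)).
- by rewrite in_fsetU [p 1 \in _]mem_seg.
- by rewrite in_fsetU qC ?orbT // ltnW.
- by rewrite in_fsetU qC ?orbT.
- rewrite in_fsetU in_fsetD1 eqxx orbF; apply/segP => -[i i_lt er].
  by move: rC; rewrite /r er (negbTE (pC _ _)) // ltnS (leq_trans i_lt).
- rewrite in_fsetU negb_or in_fsetD1 negb_and pC // orbT andbT.
  by apply/segP => -[i _ /p_inj].
- by apply: contraTneq rC; rewrite /r => ->; apply: pC.
Qed.

Definition framed_connected (v : point) (n : nat) : Prop :=
  forall P Q, framed v n P -> framed v n Q -> #|` P| = #|` Q| -> gamma P Q.

Section Stack.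

Variables (v : point) (n : nat).

Let w := shrink Top v.
Let top := side Top v n.+1.
Let p := side_point Top v n.+1.

Let top_disjoint A B :
  A `<=` top -> B `<=` tri w n -> [disjoint A & B]%fset.
Proof. exact: side_shrink_disjoint. Qed.

Lemma framed_peel Q : framed v n.+1 Q -> exists A B,
  [/\ A `<=` top, (0 < #|` A|)%N, framed w n B & gamma Q (A `|` B)].
Proof.
move=> /andP[tQ Qv]; have p0t : p 0 \in top by apply: mem_seg.
have [Y QY] := reaches_sub tQ (gamma_side_shrink p0t).
rewrite fsubUset fsub1set => /andP[p0Y TY].
have Yv := gamma_sub_filling QY (@triangle_stable _ _) Qv.
exists (Y `&` top), (Y `&` tri w n); split.
- exact: fsubsetIr.
- by rewrite cardfs_gt0; apply/fset0Pn; exists (p 0); rewrite in_fsetI p0Y.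
- by rewrite /framed fsubsetI TY side_sub fsubsetIr.
- by rewrite -fsetIUr -triS; have /fsetIidPl -> := Yv.
Qed.

Hypothesis conn : framed_connected w n.

Lemma gamma_stack A A' B B' : A `<=` top -> A' `<=` top -> #|` A| = #|` A'| ->
  framed w n B -> framed w n B' -> #|` B| = #|` B'| ->
  gamma (A `|` B) (A' `|` B').
Proof.
move=> At A't cA fB fB' cB; apply: (@gamma_trans (A `|` B')).
  rewrite ![A `|` _]fsetUC; apply: gamma_fsetU (conn fB fB' cB) _.
  by rewrite (filling_framed fB); apply: top_disjoint.
have /andP[rB' B'w] := fB'.
by apply: (gamma_slide (side_strip Top v n) At A't cA rB'); apply: top_disjoint.
Qed.

Lemma gamma_raise A B : A `<=` top -> (0 < #|` A| <= n)%N ->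
  framed w n B -> (n < #|` B|)%N -> exists B',
  [/\ framed w n B', #|` B'|.+1 = #|` B|
    & gamma (A `|` B) (seg p #|` A|.+1 `|` B')].
Proof.
move=> At /andP[A0 leAn] fB ltnB.
have n1 : (1 < n)%N.
  have /andP[_ /fsubset_leq_card] := fB; rewrite card_tri => /(leq_trans ltnB).
  by case: (n) => [|[]].
pose r := side_point Top (shrink Top w) n.-1 0.
have rw : r \in tri w n by rewrite in_triangle /=; lia.
have [C [fC cC rC]] := framed_exchange fB ltnB rw.
have rT : r \notin side Top w n by rewrite in_side /=; lia.
exists (C `\ r); split; first exact: framed_fsetD1.
  by rewrite -cC (cardfsD1 r C) rC.
have p_inj := @side_point_inj Top v n.+1.
apply: gamma_trans (gamma_raise_point n1 _ fC rC); last by rewrite A0.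
apply: gamma_stack => //; last by rewrite card_seg // => i j /p_inj[].
apply/fsubsetP => x /segP[i i_lt ->]; apply: mem_seg.
by rewrite ltnS (leq_trans i_lt).
Qed.

Lemma framed_normal_form Q : framed v n.+1 Q -> exists A B,
  [/\ A `<=` top, framed w n B, gamma Q (A `|` B)
    & #|` A| = minn (#|` Q| - n) n.+1].
Proof.
move=> /framed_peel[A [B [At A0 fB QAB]]].
have [k] := ubnP #|` B|; elim: k => // k IHk in A B At A0 fB QAB *.
rewrite ltnS => leBk; have cQ := gamma_card QAB.
have /andP[_ Bw] := fB; rewrite cardfsU_disjoint ?top_disjoint // in cQ.
have leA := fsubset_leq_card At; rewrite card_side in leA.
have leB := card_framed fB.
have [ltnB|] := ltnP n #|` B|; last by exists A, B; split=> //; lia.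
have [leAn|] := leqP #|` A| n; last by exists A, B; split=> //; lia.
have A0n : (0 < #|` A| <= n)%N by rewrite A0.
have [B' [fB' cB' mv]] := gamma_raise At A0n fB ltnB.
apply: (IHk (seg p #|` A|.+1) B') => //.
- exact: subset_seg.
- by rewrite card_seg //; apply: side_point_inj.
- exact: gamma_trans QAB mv.
- by rewrite -cB' in leBk.
Qed.

End Stack.

Lemma gamma_framed v n : framed_connected v n.
Proof.
elim: n v => [|n IHn] v P Q fP fQ cPQ.
  have empty X : framed v 0 X -> X = fset0.
    by rewrite /framed tri0 fsubset0 => /andP[_ /eqP].
  by rewrite (empty P) // (empty Q) //; apply: gamma_refl.
have [A [B [At fB PAB cA]]] := framed_normal_form (IHn _) fP.
have [A' [B' [A't fB' QAB' cA']]] := framed_normal_form (IHn _) fQ.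
apply: (gamma_trans PAB (gamma_trans _ (gamma_sym QAB'))).
have cAA' : #|` A| = #|` A'| by rewrite cA cA' cPQ.
apply: (gamma_stack (IHn _) At A't cAA' fB fB').
move: (gamma_card PAB) (gamma_card QAB').
have disj X Y := @side_shrink_disjoint Top v n X Y.
have /andP[_ Bw] := fB; have /andP[_ B'w] := fB'.
rewrite !cardfsU_disjoint ?disj //.
by rewrite cAA' cPQ => <- /addnI->.
Qed.

(** * The patterns P_{n,k} *)

Lemma translate0 A : translate 0 A = A.
Proof. by apply/fsetP => x; rewrite in_translate subr0. Qed.

Lemma card_translate v A : #|` translate v A| = #|` A|.
Proof. by rewrite card_imfset //=; apply: addrI. Qed.

Lemma lower_rows_uniq n : uniq (lower_rows n).
Proof.
apply: filter_uniq; apply: allpairs_uniq; rewrite ?rev_uniq ?iota_uniq //.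
by move=> [a b] [c d] _ _ /= [-> ->].
Qed.

Lemma mem_lower_rows n x :
  (x \in lower_rows n) = (x \in triangle n) && (x \notin side Top 0 n).
Proof.
rewrite mem_filter in_side translate0 -(translate0 (triangle n)).
case: x => a b; rewrite !in_triangle /= !subr0.
apply/andP/andP => [[abT]|[abT ab_low]].
  by case/allpairsP=> -[i j] /= []; rewrite !mem_rev !mem_iota => ? ? [ea eb];
    split=> //; lia.
split=> //; apply/allpairsP; exists (absz b, absz a).
by rewrite /= !mem_rev !mem_iota; split; [lia|lia|congr pair; lia].
Qed.

Lemma Ppattern_side n k :
  Ppattern n k = side Top 0 n `|` [fset x in take k (lower_rows n)].
Proof. by congr (_ `|` _); apply: eq_imfset => // i /=; rewrite !add0r. Qed.

Lemma size_lower_rows n : size (lower_rows n) = 'C(n, 2).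
Proof.
have -> : size (lower_rows n) = #|` tri 0 n `\` side Top 0 n|.
  have -> : tri 0 n `\` side Top 0 n = [fset x in lower_rows n].
    by apply/fsetP => x; rewrite !inE mem_lower_rows translate0 andbC.
  by rewrite card_fseq undup_id ?lower_rows_uniq.
by rewrite cardfsDS ?side_sub // card_tri card_side binS bin1 addnK.
Qed.

Lemma card_Ppattern n k : (k <= 'C(n, 2))%N -> #|` Ppattern n k| = (n + k)%N.
Proof.
move=> lek; rewrite Ppattern_side cardfsU_disjoint.
  rewrite card_side card_fseq undup_id ?take_uniq ?lower_rows_uniq //.
  by rewrite size_takel ?size_lower_rows.
apply/fdisjointP => x xT; rewrite inE; apply: contraL xT => /mem_take.
by rewrite mem_lower_rows => /andP[].
Qed.

Lemma framed_Ppattern v n k : framed v n (translate v (Ppattern n k)).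
Proof.
rewrite /framed Ppattern_side; apply/andP; split; apply/fsubsetP => x.
  by rewrite in_translate in_fsetU !in_side !in_triangle /=; lia.
rewrite !in_translate in_fsetU => /orP[/(fsubsetP (side_sub _ _ _))|].
  by rewrite translate0.
by rewrite inE => /mem_take; rewrite mem_lower_rows => /andP[].
Qed.

(** * Maximal cores *)

Definition near (x y : point) : bool := (y == x) || (y \in neighbours x).

Lemma nearE a b c d : near (a, b) (c, d) =
  [&& `|c - a| <= 1, `|d - b| <= 1 & `|(c - a) + (d - b)| <= 1].
Proof. by rewrite /near in_neighbours /= !inE !xpair_eqE; lia. Qed.

Lemma near_refl x : near x x.
Proof. by rewrite /near eqxx. Qed.

Lemma near_sym x y : near x y = near y x.
Proof. by case: x y => a b [c d]; rewrite !nearE; lia. Qed.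

Lemma near_cell v x y : x \in translate v cellT -> y \in translate v cellT ->
  near x y.
Proof.
case: v x y => u w [a b] [c d]; rewrite !in_cell nearE !xpair_eqE /=; lia.
Qed.

Definition far (A B : pattern) : Prop :=
  forall x y, x \in A -> y \in B -> ~~ near x y.

Lemma far_sym A B : far A B -> far B A.
Proof. by move=> fAB x y xB yA; rewrite near_sym fAB. Qed.

Lemma far_sub A A' B B' : A' `<=` A -> B' `<=` B -> far A B -> far A' B'.
Proof.
by move=> /fsubsetP sA /fsubsetP sB fAB x y /sA xA /sB; apply: fAB.
Qed.

Lemma far_disjoint A B : far A B -> [disjoint A & B]%fset.
Proof.
move=> fAB; apply/fdisjointP => x xA; apply/negP => /(fAB _ _ xA).
by rewrite near_refl.
Qed.

Lemma far_neighbourhood A B : far A B -> neighbourhood A `&` B = fset0.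
Proof.
move=> fAB; apply/eqP/fdisjointP => y /neighbourhoodP[x xA xy].
by apply: contraTN xy => /(fAB _ _ xA); rewrite negb_or => /andP[].
Qed.

Lemma near_triangle_side x y v n : x \in tri v n -> near x y ->
  y \notin tri v n -> exists e w, v = shrink e w /\ y \in side e w n.+1.
Proof.
case: v x y => c d [a b] [p q]; rewrite nearE !in_triangle /= => ab xy pq.
have [pR|[qT|pqD]] : p - c = n%:Z \/ q - d = n%:Z \/
    (p - c) + (q - d) = n%:Z - 2 by lia.
- exists Right, (c, d - 1).
  by rewrite in_side in_triangle /= subrK; split=> //; lia.
- exists Top, (c - 1, d).
  by rewrite in_side in_triangle /= subrK; split=> //; lia.
exists Diagonal, (c - 1, d - 1).
by rewrite in_side in_triangle /= !subrK; split=> //; lia.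
Qed.

Lemma gamma_absorb e w n y : y \in side e w n.+1 ->
  gamma (y |` side Top (shrink e w) n) (side Top w n.+1).
Proof.
move=> yS; apply: gamma_trans (gamma_sym (gamma_top_side e w n.+1)).
apply: gamma_trans (gamma_sym (gamma_side_shrink yS)).
exact/gamma_side_fsetU1/gamma_top_side/side_notin_shrink.
Qed.

Lemma framed1 x : framed x 1 [fset x].
Proof.
have eT : side Top x 1 = [fset x].
  by rewrite /side segS seg0 fsetU0 /= addr0 addrK -surjective_pairing.
by rewrite -eT framed_top.
Qed.

Lemma framed_absorb v n C x y : framed v n C -> x \in tri v n -> near x y ->
  exists w m D, framed w m D /\ gamma (y |` C) D.
Proof.
move=> /andP[TC Cv] xv xy; have [yv|yv] := boolP (y \in tri v n).
  exists v, n, (y |` C); split; last exact: gamma_refl.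
  by rewrite /framed fsubUset fsub1set yv Cv (fsubset_trans TC (fsubsetU1 _ _)).
have [e [w [ev yS]]] := near_triangle_side xv xy yv; rewrite ev in TC Cv.
have [D CD TD] := reaches_sub (fsetUS [fset y] TC) (gamma_absorb yS).
exists w, n.+1, D; split=> //; rewrite /framed TD.
apply: (gamma_sub_filling CD (@triangle_stable _ _)).
by rewrite (triS e) fsetUSS // fsub1set.
Qed.

Definition maximal_core (P : pattern) (v : point) (n : nat) (C : pattern) :
    Prop :=
  [/\ framed v n C, reaches P C & forall w m D, framed w m D -> reaches P D ->
        (#|` D| <= #|` C|)%N].

Lemma maximal_core_exists P : exists v n C, maximal_core P v n C.
Proof.
pose rep m := `[< exists v n C, [/\ framed v n C, reaches P C & #|` C| = m] >].
have rep_ex : exists m, rep m.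
  exists 0%N; apply/asboolP; exists 0, 0%N, fset0; split=> //.
  - by rewrite -[X in framed _ _ X](seg0 (side_point Top 0 0)) framed_top.
  - by exists P; [apply: gamma_refl|apply: fsub0set].
have rep_le m : rep m -> (m <= #|` P|)%N.
  move=> /asboolP[v [n [C [_ [Q PQ CQ] <-]]]].
  by rewrite -(gamma_card PQ) fsubset_leq_card.
have [m /asboolP[v [n [C [fC PC <-]]]] max_m] := ex_maxnP rep_ex rep_le.
exists v, n, C; split=> // w k D fD PD.
by apply: max_m; apply/asboolP; exists w, k, D.
Qed.

Section MaximalCore.

Variables (P : pattern) (v : point) (n : nat) (C : pattern).
Hypothesis core : maximal_core P v n C.

Lemma maximal_core_gt0 : P != fset0 -> (0 < n)%N.
Proof.
have [/andP[_ /fsubset_leq_card leC] _ C_max] := core.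
case/fset0Pn=> x xP; have Px : reaches P [fset x].
  by exists P; [apply: gamma_refl|rewrite fsub1set].
have := C_max _ _ _ (framed1 x) Px; rewrite cardfs1 => /leq_trans/(_ leC).
by case: (n) => //; rewrite tri0 cardfs0.
Qed.

Lemma maximal_core_far R : [disjoint C & R]%fset -> gamma P (C `|` R) ->
  far (tri v n) R.
Proof.
have [fC _ C_max] := core => dCR PCR x y xv yR; apply/negP => xy.
have [w [m [D [fD CD]]]] := framed_absorb fC xv xy.
have PyC : reaches P (y |` C).
  by exists (C `|` R) => //; rewrite fsetUC fsetUS ?fsub1set.
have := C_max _ _ _ fD (reaches_gamma PyC CD).
by rewrite (gamma_card CD) cardfsU1 (fdisjointP_sym dCR) // ltnn.
Qed.

Lemma maximal_core_gamma R Q : gamma R Q -> [disjoint C & R]%fset ->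
  gamma P (C `|` R) -> [disjoint C & Q]%fset /\ gamma P (C `|` Q).
Proof.
elim=> {R Q} [R Q [u [S [c2 Su S2 ->]]]||R Q S _ IHRQ _ IHQS] // dCR PCR.
  have [y [_ [_ + _]]] := card2_elems c2; rewrite in_fsetI => /andP[yR yu].
  have dCu : [disjoint C & translate u cellT]%fset.
    apply/fdisjointP => x xC; have [/andP[_ /fsubsetP Cv] _ _] := core.
    by apply: contra (maximal_core_far dCR PCR (Cv _ xC) yR) => /near_cell->.
  split.
    rewrite fdisjointXU (fdisjointWr (fsubsetDl _ _) dCR).
    exact: fdisjointWr dCu.
  apply: gamma_trans PCR _; rewrite ![C `|` _]fsetUC; apply: rt_step.
  exact: solitaire_move_fsetU.
by have [dCQ PCQ] := IHRQ dCR PCR; apply: IHQS.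
Qed.

Lemma maximal_core_far_filling R : [disjoint C & R]%fset ->
  gamma P (C `|` R) -> (forall y, y \in filling R -> reaches R [fset y]) ->
  far (tri v n) (filling R).
Proof.
move=> dCR PCR reachR x y xv /reachR[Q RQ]; rewrite fsub1set => yQ.
have [dCQ PCQ] := maximal_core_gamma RQ dCR PCR.
exact: maximal_core_far dCQ PCQ _ _ xv yQ.
Qed.

End MaximalCore.

(** * Unions of patterns that do not touch *)

Lemma far_not_touch A B : far (filling A) (filling B) -> ~ touch A B.
Proof.
by move=> fAB; case; rewrite fsetIC far_neighbourhood //; apply: far_sym.
Qed.

Lemma filling0 : filling fset0 = fset0.
Proof. by apply/eqP; rewrite -fsubset0 -(tri0 0) filling_sub_tri ?fsub0set. Qed.

Lemma filling_fsetU A B : far (filling A) (filling B) ->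
  filling (A `|` B) = filling A `|` filling B.
Proof.
move=> fAB; apply/eqP; rewrite eqEfsubset.
rewrite fsubUset !filling_mono ?fsubsetUl ?fsubsetUr // !andbT.
apply: filling_min; last by apply: fsetUSS; apply: sub_filling.
apply: fill_stableI => v x y z xv yv zv xy.
rewrite !in_fsetU => /orP[xA|xB] /orP[yA|yB].
- by rewrite (stable_cell (@filling_stable A) xv yv zv xy).
- by have := fAB _ _ xA yB; rewrite (near_cell xv yv).
- by have := fAB _ _ yA xB; rewrite (near_cell yv xv).
- by rewrite (stable_cell (@filling_stable B) xv yv zv xy) ?orbT.
Qed.

Lemma tri_neq0 v n : (0 < n)%N -> tri v n != fset0.
Proof. by move=> n0; rewrite -cardfs_gt0 card_tri bin_gt0. Qed.

Lemma triangle_decomposition0 : is_triangle_decomposition fset0 fset0.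
Proof. by split=> //; rewrite big_seq_fset0. Qed.

Lemma triangle_decomposition1 v n : (0 < n)%N ->
  is_triangle_decomposition (tri v n) [fset (v, n)].
Proof.
move=> n0; split=> [t|| t u]; rewrite ?big_seq_fset1 ?inE //.
  by move=> /eqP->.
by move=> /eqP-> /eqP->; rewrite eqxx.
Qed.

Lemma tri_sub_decomposition F D t : is_triangle_decomposition F D -> t \in D ->
  tri t.1 t.2 `<=` F.
Proof.
by move=> [_ -> _] tD; apply: (bigfcup_sup (fun t => tri t.1 t.2)).
Qed.

Lemma triangle_decompositionU F G D E : far F G ->
  is_triangle_decomposition F D -> is_triangle_decomposition G E ->
  is_triangle_decomposition (F `|` G) (D `|` E).
Proof.
move=> fFG tdF tdG.
have subF t tD := @tri_sub_decomposition F D t tdF tD.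
have subG t tE := @tri_sub_decomposition G E t tdG tE.
have [[posD eF sepD] [posE eG sepE]] := (tdF, tdG).
pose hull (t : point * nat) := tri t.1 t.2.
split=> [t|| t u]; rewrite ?in_fsetU.
- by case/orP; [apply: posD|apply: posE].
- apply/eqP; rewrite eqEfsubset fsubUset -andbA {1}eF {1}eG; apply/and3P; split;
    apply/bigfcupsP => t; rewrite ?in_fsetU.
  + by move=> tD _; apply: (bigfcup_sup hull); rewrite // in_fsetU tD.
  + by move=> tE _; apply: (bigfcup_sup hull); rewrite // in_fsetU tE orbT.
  + by move=> /orP[/subF|/subG] sub _; rewrite fsubsetU ?sub ?orbT.
- move=> /orP[tD|tE] /orP[uD|uE] ne.
  + exact: sepD.
  + exact/far_neighbourhood/(far_sub (subF _ tD) (subG _ uE)).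
  + exact/far_neighbourhood/far_sym/(far_sub (subF _ uD) (subG _ tE)).
  + exact: sepE.
Qed.

Lemma triangle_decomposition_disjoint F G D E : [disjoint F & G]%fset ->
  is_triangle_decomposition F D -> is_triangle_decomposition G E ->
  [disjoint D & E]%fset.
Proof.
move=> /fdisjointP dFG tdF tdG; apply/fdisjointP => t tD; apply/negP => tE.
have [[posD _ _] /fsubsetP tF] := (tdF, tri_sub_decomposition tdF tD).
have /fset0Pn[x xt] := tri_neq0 t.1 (posD _ tD).
have := dFG _ (tF _ xt).
by rewrite (fsubsetP (tri_sub_decomposition tdG tE)).
Qed.

Lemma filling_triangles_eq P D :
  is_triangle_decomposition (filling P) D -> filling_triangles P = D.
Proof. exact/triangle_decomposition_uniq/filling_trianglesP. Qed.

Lemma excess_gamma P Q : gamma P Q -> excess Q = excess P.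
Proof.
move=> PQ; have eT : filling_triangles Q = filling_triangles P.
  apply: filling_triangles_eq; rewrite (gamma_filling PQ).
  exact: filling_trianglesP.
by rewrite /excess (gamma_card PQ) eT.
Qed.

Lemma excess0 : excess fset0 = 0.
Proof.
rewrite /excess cardfs0 (@filling_triangles_eq _ fset0) ?big_seq_fset0 //.
by rewrite filling0; apply: triangle_decomposition0.
Qed.

Lemma excess_framed v n P : (0 < n)%N -> framed v n P ->
  excess P = #|` P|%:Z - n%:Z.
Proof.
move=> n0 fP; rewrite /excess (@filling_triangles_eq _ [fset (v, n)]).
  by rewrite big_seq_fset1.
by rewrite (filling_framed fP); apply: triangle_decomposition1.
Qed.

Lemma far_filling_disjoint A B : far (filling A) (filling B) ->
  [disjoint A & B]%fset.
Proof. by move/(far_sub (sub_filling A) (sub_filling B))/far_disjoint. Qed.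

Lemma excess_fsetU A B : far (filling A) (filling B) ->
  excess (A `|` B) = excess A + excess B.
Proof.
move=> fAB; have [dA dB] := (filling_trianglesP A, filling_trianglesP B).
rewrite /excess cardfsU_disjoint ?far_filling_disjoint //.
have dU := triangle_decompositionU fAB dA dB; rewrite -filling_fsetU // in dU.
rewrite (filling_triangles_eq dU) big_fsetU_disjoint /=.
  by rewrite PoszD opprD addrACA.
exact: triangle_decomposition_disjoint (far_disjoint fAB) dA dB.
Qed.

Definition placed (t : point * nat * nat) : pattern :=
  translate t.1.1 (Ppattern t.1.2 t.2).

Definition placed_union (D : seq (point * nat * nat)) : pattern :=
  \bigcup_(t <- D) placed t.

Definition admissible (t : point * nat * nat) : bool :=
  (0 < t.1.2)%N && (t.2 <= 'C(t.1.2, 2))%N.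

Fixpoint separated (D : seq (point * nat * nat)) : Prop :=
  if D is t :: D' then
    [/\ admissible t, far (filling (placed t)) (filling (placed_union D'))
      & separated D']
  else True.

Lemma placed_union_cons t D :
  placed_union (t :: D) = placed t `|` placed_union D.
Proof. exact: big_cons. Qed.

Lemma filling_placed t : filling (placed t) = tri t.1.1 t.1.2.
Proof. exact/filling_framed/framed_Ppattern. Qed.

Lemma card_placed t : admissible t -> #|` placed t| = (t.1.2 + t.2)%N.
Proof. by move=> /andP[_ lek]; rewrite card_translate card_Ppattern. Qed.

Lemma excess_placed t : admissible t -> excess (placed t) = t.2%:Z.
Proof.
move=> adm; have /andP[n0 _] := adm.
by rewrite (excess_framed n0 (framed_Ppattern _ _ _)) card_placed //; lia.
Qed.

Lemma card_separated D : separated D ->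
  #|` placed_union D|%:Z = \sum_(t <- D) t.1.2%:Z + \sum_(t <- D) t.2%:Z.
Proof.
elim: D => [_|t D IHD /= [adm far_t sD]].
  by rewrite /placed_union !big_nil cardfs0.
rewrite placed_union_cons cardfsU_disjoint ?far_filling_disjoint //.
by rewrite !big_cons PoszD IHD // card_placed // PoszD addrACA.
Qed.

Lemma excess_separated D : separated D ->
  excess (placed_union D) = \sum_(t <- D) t.2%:Z.
Proof.
elim: D => [_|t D IHD /= [adm far_t sD]].
  by rewrite /placed_union !big_nil excess0.
by rewrite placed_union_cons excess_fsetU // big_cons IHD // excess_placed.
Qed.

Lemma separated_admissible D t : separated D -> t \in D -> admissible t.
Proof.
elim: D => //= u D IHD [adm _ sD]; rewrite inE => /predU1P[->|] //.
exact: IHD.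
Qed.

Lemma separated_far t0 D i j : separated D -> (i < j < size D)%N ->
  far (filling (placed (nth t0 D i))) (filling (placed (nth t0 D j))).
Proof.
elim: D i j => [|t D IHD] i j /=; first by rewrite ltn0 andbF.
case: i j => [|i] [|j] //= [_ far_t sD]; last exact: IHD.
rewrite ltnS => j_lt; apply: far_sub far_t; first exact: fsubset_refl.
by apply/filling_mono/bigfcup_sup; rewrite ?mem_nth.
Qed.

Lemma separated_reaches D y : separated D -> y \in filling (placed_union D) ->
  reaches (placed_union D) [fset y].
Proof.
elim: D => [_|t D IHD /= [_ far_t sD]].
  by rewrite /placed_union big_nil filling0.
rewrite placed_union_cons filling_fsetU // in_fsetU => /orP[|/(IHD sD)].
  rewrite filling_placed => /top_reaches; apply: reaches_mono.
  have /andP[Tt _] := framed_Ppattern t.1.1 t.1.2 t.2.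
  exact: fsubset_trans Tt (fsubsetUl _ _).
exact/reaches_mono/fsubsetUr.
Qed.

Lemma separated_exists P : exists2 D, separated D & gamma (placed_union D) P.
Proof.
have [m] := ubnP #|` P|; elim: m => // m IHm in P *; rewrite ltnS => leP.
have [->|P0] := eqVneq P fset0.
  by exists [::] => //; rewrite /placed_union big_nil; apply: gamma_refl.
have [v [n [C core]]] := maximal_core_exists P.
have [fC [Q PQ CQ] _] := core; have n0 := maximal_core_gt0 core P0.
have dCQ : [disjoint C & Q `\` C]%fset.
  by apply/fdisjointP => x xC; rewrite in_fsetD xC.
have PCQ : gamma P (C `|` Q `\` C).
  by rewrite fsetUDl fsetDv fsetD0 (fsetUidPr _ _ CQ).
have [|D sD DQ] := IHm (Q `\` C).
  have := fsubset_leq_card CQ; have := card_framed fC.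
  by rewrite cardfsDS // (gamma_card PQ); lia.
have [dCD PCD] := maximal_core_gamma core (gamma_sym DQ) dCQ PCQ.
have reachD y := @separated_reaches D y sD.
have far_D := maximal_core_far_filling core dCD PCD reachD.
pose t := (v, n, (#|` C| - n)%N).
have adm : admissible t.
  have /andP[_ /fsubset_leq_card] := fC.
  by rewrite /admissible n0 card_tri binS bin1 leq_subLR addnC.
exists (t :: D); first by split; rewrite ?filling_placed.
rewrite placed_union_cons; apply: gamma_trans (gamma_sym PCD).
apply: gamma_fsetU; last first.
  rewrite fdisjoint_sym filling_placed.
  exact/far_disjoint/(far_sub (fsubset_refl _) (sub_filling _) far_D).
apply: (gamma_framed (framed_Ppattern _ _ _) fC).
by rewrite -/(placed t) card_placed //= subnKC ?(card_framed fC).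
Qed.

Theorem theorem3 (P : pattern) (P_nonempty : P != fset0) :
  exists (r : nat) (n k : 'I_r -> nat) (v : 'I_r -> int * int),
    [/\ forall i, (1 <= n i)%N /\ (k i <= (n i * (n i - 1)) %/ 2)%N,
        gamma (\big[fsetU/fset0]_(i < r) translate (v i) (Ppattern (n i) (k i))) P,
        forall i j : 'I_r, i != j ->
          ~ touch (translate (v i) (Ppattern (n i) (k i)))
                  (translate (v j) (Ppattern (n j) (k j))),
        (\sum_(i < r) (n i)%:Z) = #|` P|%:Z - excess P
      & (\sum_(i < r) (k i)%:Z) = excess P].
Proof.
have [D sD DP] := separated_exists P.
pose T (i : 'I_(size D)) := nth (0, 0%N, 0%N) D i.
have sumD F : \sum_(i < size D) F (T i) = \sum_(t <- D) F t :> int.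
  by rewrite (big_nth (0, 0%N, 0%N)) big_mkord.
exists (size D), (fun i => (T i).1.2), (fun i => (T i).2), (fun i => (T i).1.1).
split.
- move=> i; have TD : T i \in D by apply: mem_nth.
  have /andP[n0 lek] := separated_admissible sD TD.
  by rewrite subn1 divn2 -bin2.
- by move: DP; rewrite /placed_union (big_nth (0, 0%N, 0%N)) big_mkord.
- move=> i j; rewrite neq_ltn => /orP[lt_ij|lt_ji]; apply: far_not_touch.
    by apply: separated_far; rewrite ?lt_ij /=.
  by apply/far_sym/separated_far; rewrite ?lt_ji /=.
- rewrite (sumD (fun t => t.1.2%:Z)) (gamma_card DP) card_separated //.
  by rewrite (excess_gamma DP) excess_separated // addrK.
- by rewrite (sumD (fun t => t.2%:Z)) (excess_gamma DP) excess_separated.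
Qed.
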